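(* Let $X$ be a compact convex set in $\mathbb{R}^n$ and let $\theta$ be locally Lipschitz continuous on $X$. Let the surrogate functions $\widehat V(\bullet;x')$, $x'\in X$, satisfy conditions (SR1), (SR2) and (SR3) stated in the context, and let $\rho>0$. Let $\widehat x$ be a fixed point of $\mathcal M_{\widetilde V_\rho}$ (thus a C-stationary point of $\min_{x\in X}\theta(x)$ by (SR2)). If $\widehat x$ is metrically subregular, i.e. there exist positive constants $\delta$ and $\eta$ such that for all $x\in X$, $$\|x-\widehat x\|\le\delta\ \Longrightarrow\ \mathrm{dist}(x;S^C_{X,\theta})\le\eta\,r^C_{X,\theta}(x),$$ then there exist positive scalars $\delta'$ and $\eta'$ such that for all $x\in X$, $$x\in\mathbb{B}(\widehat x;\delta')\ \Longrightarrow\ \mathrm{dist}(x;S^C_{X,\theta})\le\eta'\,r_{\widetilde V_\rho}(x).$$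
   Context: The norm is Euclidean and $\mathbb{B}(\widehat x;\delta')$ is the Euclidean ball of center $\widehat x$ and radius $\delta'$. $\theta$ is real-valued and locally Lipschitz continuous so that its Clarke subdifferential $\partial_C\theta(x)$ is well defined at every $x\in X$; $\mathcal N(x;X)$ is the normal cone of $X$ at $x$. $S^C_{X,\theta}=\{x\in X: 0\in\partial_C\theta(x)+\mathcal N(x;X)\}$ is the set of C(larke)-stationary points, and $r^C_{X,\theta}(x)=\mathrm{dist}(0;\partial_C\theta(x)+\mathcal N(x;X))$. (SR1) For every $x'\in X$ there is a convex function $\widehat V(\bullet;x')$ on $X$ with (i) $\widehat V(x';x')=\theta(x')$; (ii) $\widehat V(x;x')\ge\theta(x)$ for all $x\in X$; (iii) for some constant $\kappa>0$ independent of $x'$, $\theta(x)+\frac\kappa2\|x-x'\|^2\ge\widehat V(x;x')$ for all $x\in X$. (SR2) $\{x\in X: x\in\operatorname{argmin}_{y\in X}\widehat V(y;x)\}\subseteq S^C_{X,\theta}$ (equivalently, the fixed points in $X$ of the map $\mathcal M_{\widetilde V_\rho}$ below lie in $S^C_{X,\theta}$ for any $\rho>0$). (SR3) The set-valued map $(x,x')\in X\times X\mapsto\partial_x\widehat V(x;x')$ (convex subdifferential of $\widehat V(\bullet;x')$ at $x$) is closed: its graph $\{(a,x,x')\in\mathbb{R}^n\times X\times X: a\in\partial_x\widehat V(x;x')\}$ is a closed set. For $\rho>0$: $\widetilde V_\rho(x;x')=\widehat V(x;x')+\frac1{2\rho}\|x-x'\|^2$, $\mathcal M_{\widetilde V_\rho}(x')$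 is the unique minimizer of $\widetilde V_\rho(\bullet;x')$ over $X$, and $r_{\widetilde V_\rho}(x)=\|x-\mathcal M_{\widetilde V_\rho}(x)\|$. *)

(* Defs.v *)
From HB Require Import structures.
From mathcomp Require Import all_boot all_order all_algebra.
From mathcomp Require Import all_classical all_reals all_analysis.
Set Implicit Arguments.
Unset Strict Implicit.
Unset Printing Implicit Defensive.
Import Order.TTheory GRing.Theory Num.Theory.
Import numFieldNormedType.Exports.
Local Open Scope classical_set_scope.
Local Open Scope ring_scope.

(* [`|x|] on ['rV[R]_n] is the sup norm, so the Euclidean structure is defined
   separately.  Both norms induce the topology carried by ['rV[R]_n], hence
   [compact], [closed] and [nbhs] are the usual notions. *)
Definition dot (R : realType) (n : nat) (x y : 'rV[R]_n) : R :=
  \sum_(i < n) x 0 i * y 0 i.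

Definition enorm (R : realType) (n : nat) (x : 'rV[R]_n) : R :=
  Num.sqrt (dot x x).

Definition eball (R : realType) (n : nat) (c : 'rV[R]_n) (r : R) :
    set 'rV[R]_n :=
  [set x | enorm (x - c) <= r].

(* Extended-real valued: the distance to the empty set is [+oo]. *)
Definition edist_set (R : realType) (n : nat) (x : 'rV[R]_n)
    (A : set 'rV[R]_n) : \bar R :=
  ereal_inf [set (enorm (x - y))%:E | y in A].

(* Lipschitz near every point of [X]; the neighborhoods are taken in the whole
   space, not relative to [X], since [clarke_dd] below evaluates [theta] off
   [X]. *)
Definition locally_lipschitz_on (R : realType) (n : nat) (X : set 'rV[R]_n)
    (theta : 'rV[R]_n -> R) : Prop :=
  forall x, X x -> exists L : R, \forall y \near x & z \near x,
    `|theta y - theta z| <= L * enorm (y - z).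

(* limsup of (theta (y + t v) - theta y) / t as y -> x and t -> 0+, with the
   pair (y, t) encoded as [p]. *)
Definition clarke_dd (R : realType) (n : nat) (theta : 'rV[R]_n -> R)
    (x v : 'rV[R]_n) : \bar R :=
  limf_esup
    (fun p : 'rV[R]_n * R => ((theta (p.1 + p.2 *: v) - theta p.1) / p.2)%:E)
    (filter_prod (nbhs x) (0 : R)^'+).

Definition clarke_subdiff (R : realType) (n : nat) (theta : 'rV[R]_n -> R)
    (x : 'rV[R]_n) : set 'rV[R]_n :=
  [set a | forall v, ((dot a v)%:E <= clarke_dd theta x v)%E].

(* Meant for [x] in the convex set [X]. *)
Definition normal_cone (R : realType) (n : nat) (X : set 'rV[R]_n)
    (x : 'rV[R]_n) : set 'rV[R]_n :=
  [set v | forall y, X y -> dot v (y - x) <= 0].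

Definition clarke_normal_sum (R : realType) (n : nat) (X : set 'rV[R]_n)
    (theta : 'rV[R]_n -> R) (x : 'rV[R]_n) : set 'rV[R]_n :=
  [set a + v | a in clarke_subdiff theta x & v in normal_cone X x].

Definition C_stationary (R : realType) (n : nat) (X : set 'rV[R]_n)
    (theta : 'rV[R]_n -> R) : set 'rV[R]_n :=
  [set x | X x /\ clarke_normal_sum X theta x 0].

Definition C_residual (R : realType) (n : nat) (X : set 'rV[R]_n)
    (theta : 'rV[R]_n -> R) (x : 'rV[R]_n) : \bar R :=
  edist_set 0 (clarke_normal_sum X theta x).

Definition argmin (R : realType) (n : nat) (X : set 'rV[R]_n)
    (f : 'rV[R]_n -> R) : set 'rV[R]_n :=
  [set z | X z /\ forall y, X y -> f z <= f y].

(* Subdifferential of a convex function whose domain is [X] : the values of [f]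
   outside [X] are irrelevant. *)
Definition convex_subdiff (R : realType) (n : nat) (X : set 'rV[R]_n)
    (f : 'rV[R]_n -> R) (x : 'rV[R]_n) : set 'rV[R]_n :=
  [set a | X x /\ forall y, X y -> f x + dot a (y - x) <= f y].

(* [V x x'] stands for the surrogate at [x] with base point [x']; only its
   values on [X * X] matter. *)
Definition SR1 (R : realType) (n : nat) (X : set 'rV[R]_n)
    (theta : 'rV[R]_n -> R) (V : 'rV[R]_n -> 'rV[R]_n -> R) : Prop :=
  [/\ forall x', X x' -> convex_function X (fun x => V x x'),
      forall x', X x' -> V x' x' = theta x',
      forall x' x, X x' -> X x -> theta x <= V x x' &
      exists2 kappa : R, 0 < kappa &
        forall x' x, X x' -> X x ->
          V x x' <= theta x + kappa / 2 * enorm (x - x') ^+ 2].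

Definition SR2 (R : realType) (n : nat) (X : set 'rV[R]_n)
    (theta : 'rV[R]_n -> R) (V : 'rV[R]_n -> 'rV[R]_n -> R) : Prop :=
  [set x | X x /\ argmin X (fun y => V y x) x] `<=` C_stationary X theta.

Definition SR3 (R : realType) (n : nat) (X : set 'rV[R]_n)
    (V : 'rV[R]_n -> 'rV[R]_n -> R) : Prop :=
  closed [set p : 'rV[R]_n * 'rV[R]_n * 'rV[R]_n |
    let: (a, x, x') := p in
    [/\ X x, X x' & convex_subdiff X (fun y => V y x') x a]].

Definition prox_surrogate (R : realType) (n : nat)
    (V : 'rV[R]_n -> 'rV[R]_n -> R) (rho : R) (x x' : 'rV[R]_n) : R :=
  V x x' + (2 * rho)^-1 * enorm (x - x') ^+ 2.

(* The minimizer is unique by strong convexity; the value chosen by [get] when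
   there is none is irrelevant, since one exists for every [x'] in [X] under the
   standing assumptions ([X] compact convex, [SR1], [SR3], [0 < rho]). *)
Definition prox_map (R : realType) (n : nat) (X : set 'rV[R]_n)
    (V : 'rV[R]_n -> 'rV[R]_n -> R) (rho : R) (x' : 'rV[R]_n) : 'rV[R]_n :=
  get (argmin X (fun x => prox_surrogate V rho x x')).

Definition prox_residual (R : realType) (n : nat) (X : set 'rV[R]_n)
    (V : 'rV[R]_n -> 'rV[R]_n -> R) (rho : R) (x : 'rV[R]_n) : R :=
  enorm (x - prox_map X V rho x).

(* Main.v *)
(* Fix [x] in [X] near [xhat], let [y] be its proximal point and [r = |x - y|].
   By (SR1), a minimizer [z] over [X] of [theta + c |. - x|^2], with [c] large
   enough, satisfies [|z - x| <= K r], and Fermat's rule for the Clarke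
   subdifferential bounds its residual by [2 c |z - x|].  If [r] is small, metric
   subregularity applies at [z]; otherwise [|x - xhat|] is already at most a
   multiple of [r], and [xhat] is stationary by (SR2).

   Existence of proximal points needs (SR3), since a convex function on [X] may
   fail to be lower semicontinuous on the relative boundary: minimizers over
   copies of [X] shrunk into its relative interior carry bounded subgradients,
   and closedness of the subdifferential graph makes their cluster points
   minimizers over [X]. *)
Require Import Defs.
From HB Require Import structures.
From mathcomp Require Import all_boot all_order all_algebra.
From mathcomp Require Import all_classical all_reals all_analysis.
From mathcomp Require Import ring lra.
Set Implicit Arguments.
Unset Strict Implicit.
Unset Printing Implicit Defensive.
Import Order.TTheory GRing.Theory Num.Theory.
Import numFieldNormedType.Exports.
Local Open Scope classical_set_scope.
Local Open Scope ring_scope.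

(** * Euclidean norm *)

Section euclidean.
Context {R : realType} {n : nat}.
Implicit Types (x y z v : 'rV[R]_n) (s : R).

Lemma dotC x y : dot x y = dot y x.
Proof. by apply: eq_bigr => i _; rewrite mulrC. Qed.

Lemma dotDl x y z : dot (x + y) z = dot x z + dot y z.
Proof. by rewrite -big_split; apply: eq_bigr => i _; rewrite mxE mulrDl. Qed.

Lemma dotZl s x y : dot (s *: x) y = s * dot x y.
Proof. by rewrite mulr_sumr; apply: eq_bigr => i _; rewrite mxE mulrA. Qed.

Lemma dotNl x y : dot (- x) y = - dot x y.
Proof. by rewrite -scaleN1r dotZl mulN1r. Qed.

Lemma dotDr x y z : dot x (y + z) = dot x y + dot x z.
Proof. by rewrite dotC dotDl !(dotC x). Qed.

Lemma dotZr s x y : dot x (s *: y) = s * dot x y.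
Proof. by rewrite dotC dotZl dotC. Qed.

Lemma dotNr x y : dot x (- y) = - dot x y.
Proof. by rewrite dotC dotNl dotC. Qed.

Lemma dot0r x : dot x 0 = 0.
Proof. by rewrite -(scale0r x) dotZr mul0r. Qed.

Lemma dot_delta x (i : 'I_n) : dot x (delta_mx 0 i) = x 0 i.
Proof.
rewrite /dot (bigD1 i) //= mxE !eqxx mulr1 big1 ?addr0 // => j ji.
by rewrite mxE (negbTE ji) andbF mulr0.
Qed.

Lemma dotxx_ge0 x : 0 <= dot x x.
Proof. by apply: sumr_ge0 => i _; rewrite -expr2 sqr_ge0. Qed.

Lemma enorm_ge0 x : 0 <= enorm x.
Proof. exact: sqrtr_ge0. Qed.

Lemma sqr_enorm x : enorm x ^+ 2 = dot x x.
Proof. by rewrite sqr_sqrtr // dotxx_ge0. Qed.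

Lemma sqr_enormDZ x y s : enorm (x + s *: y) ^+ 2 =
  enorm x ^+ 2 + 2 * s * dot x y + s ^+ 2 * enorm y ^+ 2.
Proof.
by rewrite !sqr_enorm !dotDl !dotDr !dotZl !dotZr (dotC y x); ring.
Qed.

Lemma enormZ s x : enorm (s *: x) = `|s| * enorm x.
Proof. by rewrite /enorm dotZl dotZr mulrA -expr2 sqrtrM ?sqr_ge0// sqrtr_sqr. Qed.

Lemma enormN x : enorm (- x) = enorm x.
Proof. by rewrite /enorm dotNl dotNr opprK. Qed.

Lemma enormB x y : enorm (x - y) = enorm (y - x).
Proof. by rewrite -enormN opprB. Qed.

Lemma enorm0 : enorm (0 : 'rV[R]_n) = 0.
Proof. by rewrite /enorm dot0r sqrtr0. Qed.

Lemma enorm_delta (i : 'I_n) : enorm (delta_mx 0 i : 'rV[R]_n) = 1.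
Proof. by rewrite /enorm dot_delta mxE !eqxx sqrtr1. Qed.

Lemma norm_coord_le_enorm x (i : 'I_n) : `|x 0 i| <= enorm x.
Proof.
rewrite -sqrtr_sqr ler_sqrt ?dotxx_ge0 // /dot (bigD1 i) //= -expr2 lerDl.
by apply: sumr_ge0 => j _; rewrite -expr2 sqr_ge0.
Qed.

Lemma enorm_eq0 x : enorm x = 0 -> x = 0.
Proof.
move=> x0; apply/rowP => i; apply/eqP.
by rewrite mxE -normr_le0 -x0 norm_coord_le_enorm.
Qed.

Lemma cauchy_schwarz x y : dot x y <= enorm x * enorm y.
Proof.
have [x0|x0] := eqVneq (enorm x) 0.
  by rewrite x0 mul0r (enorm_eq0 x0) dotC dot0r.
have [y0|y0] := eqVneq (enorm y) 0.
  by rewrite y0 mulr0 (enorm_eq0 y0) dot0r.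
have xgt : 0 < enorm x by rewrite lt_def x0 enorm_ge0.
have ygt : 0 < enorm y by rewrite lt_def y0 enorm_ge0.
(* The squared norm of this vector is [2 |x| |y| (|x| |y| - dot x y)], and the factor [2 |x| |y|] is
   positive. *)
have := dotxx_ge0 (enorm y *: x - enorm x *: y).
rewrite !(dotDl, dotDr, dotNl, dotNr, dotZl, dotZr) -!sqr_enorm (dotC y x).
move=> h; have {}h : 0 <= (enorm x * enorm y) * (enorm x * enorm y - dot x y).
  by rewrite -(@pmulr_rge0 _ 2) //; lra.
by move: h; rewrite pmulr_rge0 ?mulr_gt0 // subr_ge0.
Qed.

Lemma normr_dot_le x y : `|dot x y| <= enorm x * enorm y.
Proof.
by rewrite ler_norml cauchy_schwarz lerNl -dotNl -(enormN x) cauchy_schwarz.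
Qed.

Lemma enormD x y : enorm (x + y) <= enorm x + enorm y.
Proof.
rewrite -(@ler_pXn2r _ 2) ?nnegrE ?addr_ge0 ?enorm_ge0 //.
rewrite sqrrD !sqr_enorm !dotDl !dotDr (dotC y x).
by have := cauchy_schwarz x y; lra.
Qed.

Lemma enorm_triangle z x y : enorm (x - y) <= enorm (x - z) + enorm (z - y).
Proof. by rewrite -(subrKA z x) enormD. Qed.

Lemma continuous_dotl y : continuous (fun x => dot x y : R^o).
Proof.
have c i : continuous (fun x : 'rV[R]_n => x 0 i * y 0 i : R^o).
  by move=> x; apply: continuousM; [exact: coord_continuous|exact: cst_continuous].
apply: continuous_big => [|i _]; first exact: add_continuous.
exact: c.
Qed.

Lemma continuous_dotr y : continuous (fun x => dot y x : R^o).
Proof.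
under eq_fun do rewrite dotC.
exact: continuous_dotl.
Qed.

Lemma continuous_enorm : continuous (@enorm R n : 'rV[R]_n -> R^o).
Proof.
have c i : continuous (fun x : 'rV[R]_n => x 0 i * x 0 i : R^o).
  by move=> x; apply: continuousM; exact: coord_continuous.
move=> x; apply: (@continuous_comp _ _ _ (fun x => dot x x : R^o)).
  by apply: continuous_big => [|i _]; [exact: add_continuous|exact: c].
exact: sqrt_continuous.
Qed.

Lemma continuous_enormB z : continuous (fun x => enorm (x - z) : R^o).
Proof.
move=> x; apply: (@continuous_comp _ _ _ (fun x => x - z)).
  apply: continuousB; first by move=> A.
  exact: cst_continuous.
exact: continuous_enorm.
Qed.

Lemma near_enorm_lt z (e : R) : 0 < e -> \forall x \near z, enorm (x - z) < e.
Proof.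
move=> e0.
have c : enorm (x - z) @[x --> z] --> (enorm (z - z) : R^o).
  exact: continuous_enormB.
by apply: (cvgr_lt _ c); rewrite subrr enorm0.
Qed.

End euclidean.

(** * Sublinear functions *)

Section hahn_banach.
Context {R : realType} {n : nat}.
Implicit Types (p q : 'rV[R]_n -> R) (T : set 'rV[R]_n) (v w d b : 'rV[R]_n).

Definition sublinear p :=
  (forall s v, 0 <= s -> p (s *: v) <= s * p v) /\
  (forall v w, p (v + w) <= p v + p w).

Definition convex_cone T :=
  [/\ T 0, forall s d, 0 <= s -> T d -> T (s *: d) &
      forall d e, T d -> T e -> T (d + e)].

Lemma sublinear0 p : sublinear p -> p 0 = 0.
Proof.
move=> [pZ pD]; have := pZ 0 0 (lexx 0); have := pD 0 0.
by rewrite addr0 scale0r mul0r; lra.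
Qed.

Lemma sublinearN p v : sublinear p -> - p (- v) <= p v.
Proof.
by move=> sp; have [_ /(_ v (- v))] := sp; rewrite subrr sublinear0 //; lra.
Qed.

(* Witness: [q v = inf_(d in T) (p (v + d) - dot b d)].  With [T] a ray along a
   basis vector this is one step of Hahn-Banach; with [T] the cone of feasible
   directions it produces the normal vector in Fermat's rule. *)
Lemma sublinear_below_cone p T b : sublinear p -> convex_cone T ->
  (forall d, T d -> dot b d <= p d) ->
  exists q, [/\ sublinear q, forall v, q v <= p v &
    forall d, T d -> q (- d) <= - dot b d].
Proof.
move=> sp [T0 TZ TD] bp; have [pZ pD] := sp.
pose S v := [set p (v + d) - dot b d | d in T].
have Slb v : has_lbound (S v).
  exists (- p (- v)) => _ [d Td <-].
  have := pD (v + d) (- v); rewrite addrAC subrr add0r.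
  by have := bp _ Td; lra.
have S0 v : S v !=set0 by exists (p (v + 0) - dot b 0); exists 0.
pose q v := inf (S v).
have qle v d : T d -> q v <= p (v + d) - dot b d.
  by move=> Td; apply: ge_inf => //; exists d.
have qge v c : (forall d, T d -> c <= p (v + d) - dot b d) -> c <= q v.
  by move=> h; apply: lb_le_inf => // _ [d Td <-]; exact: h.
exists q; split; first split.
- move=> s v; rewrite le_eqVlt => /predU1P[<-|s0].
    rewrite scale0r mul0r; apply: (le_trans (qle _ _ T0)).
    by rewrite add0r dot0r subr0 sublinear0.
  rewrite -ler_pdivrMl //; apply: (qge) => d Td; rewrite ler_pdivrMl //.
  apply: (le_trans (qle _ (s *: d) _)); first by apply: TZ; [exact: ltW|].
  rewrite dotZr -scalerDr mulrBr lerB // pZ //; exact: ltW.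
- move=> v w; rewrite -lerBlDr; apply: (qge) => d Td.
  rewrite lerBlDl -lerBlDr; apply: (qge) => e Te; rewrite lerBlDr.
  apply: (le_trans (qle _ (d + e) (TD _ _ Td Te))).
  by have := pD (v + d) (w + e); rewrite addrACA dotDr; lra.
- by move=> v; have := qle v _ T0; rewrite addr0 dot0r subr0.
- move=> d Td; have := qle (- d) _ Td.
  by rewrite addNr sublinear0 // sub0r.
Qed.

(** One Hahn-Banach step: with [T] the ray along the basis vector [e] and [b = p e *: e], the
    minorant satisfies [q (- e) <= - p e <= - q e], which makes it linear on that axis. *)
Lemma sublinear_linear_coord p (i : 'I_n) : sublinear p ->
  exists q, [/\ sublinear q, forall v, q v <= p v &
    q (- delta_mx 0 i) <= - q (delta_mx 0 i)].
Proof.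
move=> sp; pose e := delta_mx 0 i : 'rV[R]_n.
pose T := [set s *: e | s in [set s : R | 0 <= s]].
have cT : convex_cone T.
  split; first by exists 0; rewrite /= ?scale0r.
    move=> s _ s0 [t /= t0 <-]; exists (s * t); first exact: mulr_ge0.
    by rewrite scalerA.
  move=> _ _ [s /= s0 <-] [t /= t0 <-]; exists (s + t); first exact: addr_ge0.
  by rewrite scalerDl.
have [|q [sq qp qT]] := @sublinear_below_cone p T (p e *: e) sp cT.
  move=> _ [s /= s0 <-]; rewrite dotZr dotZl dot_delta mxE !eqxx mulr1.
  have [->|sn0] := eqVneq s 0; first by rewrite scale0r sublinear0 // mul0r.
  have sgt : 0 < s by rewrite lt_def sn0.
  rewrite -ler_pdivlMl //.
  have := sp.1 s^-1 (s *: e); rewrite scalerA mulVf // scale1r; apply.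
  by rewrite invr_ge0.
exists q; split=> //.
have Te : T e by exists 1; rewrite /= ?scale1r ?ler01.
have := qT e Te; rewrite dotZl dot_delta mxE !eqxx mulr1.
by move/le_trans; apply; rewrite lerN2.
Qed.

(** Finite-dimensional Hahn-Banach: one step per axis yields a minorant [q] linear on every axis,
    and [a] collects its values on the basis. Subadditivity gives [q <= dot a] everywhere; used at
    [- v], this reads [dot a v <= - q (- v) <= q v]. *)
Lemma dot_below_sublinear p : sublinear p ->
  exists a, forall v, dot a v <= p v.
Proof.
move=> sp.
have [q [sq qp qlin]] : exists q, [/\ sublinear q, forall v, q v <= p v &
    forall i, i \in enum 'I_n -> q (- delta_mx 0 i) <= - q (delta_mx 0 i)].
  elim: (enum _) => [|i s [q [sq qp qs]]]; first by exists p; split.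
  have [r [sr rq ri]] := @sublinear_linear_coord q i sq.
  exists r; split => // [v|j].
    exact: le_trans (qp v).
  (* Linearity on an earlier axis survives because [r <= q]: [r (- e_j) <= q (- e_j) <= - q e_j <= -
     r e_j]. *)
  rewrite inE => /predU1P[->//|/qs qj].
  have := sublinearN (delta_mx 0 j) sq; have := rq (delta_mx 0 j).
  have := rq (- delta_mx 0 j); have := sublinearN (- delta_mx 0 j) sr.
  by rewrite opprK; move: qj; lra.
pose a := \row_i q (delta_mx 0 i).
exists a => v; apply: le_trans (qp v).
have le1 w : q w <= dot a w.
  rewrite {1}(row_sum_delta w) /dot.
  have : forall i, true -> q (w 0 i *: delta_mx 0 i) <= a 0 i * w 0 i.
    move=> i _; rewrite mxE mulrC; have [w0|w0] := leP 0 (w 0 i).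
      exact: sq.1.
    have -> : w 0 i *: delta_mx 0 i = - w 0 i *: - delta_mx 0 i.
      by move=> m; rewrite scalerN scaleNr opprK.
    apply: (le_trans (sq.1 _ _ _)); first by rewrite oppr_ge0 ltW.
    have := qlin i; rewrite mem_enum inE => /(_ isT).
    by rewrite mulNr -mulrN => qi; rewrite ler_nM2l // lerNr.
  move=> h; apply: (@big_ind2 _ _ (fun x y => q x <= y)) => //.
    by rewrite sublinear0.
  by move=> x1 x2 y1 y2 h1 h2; apply: (le_trans (sq.2 _ _)); exact: lerD.
apply: le_trans (sublinearN v sq).
by rewrite -lerN2 opprK -dotNr le1.
Qed.
End hahn_banach.

(** * Clarke directional derivative and Fermat's rule *)

Section limf_esup.
Context {R : realType} {T : choiceType} {X : filteredType T}
  (f : X -> \bar R) (F : set_system X).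

Lemma limf_esup_le c : (\forall x \near F, (f x <= c)%E) -> (limf_esup f F <= c)%E.
Proof.
move=> Fc; apply: ge_ereal_inf; exists (ereal_sup (f @` [set x | (f x <= c)%E])).
  by exists [set x | (f x <= c)%E].
by apply: ge_ereal_sup => _ [x /= fx <-].
Qed.

Lemma near_lt_limf_esup {FF : Filter F} c :
  (limf_esup f F < c)%E -> \forall x \near F, (f x < c)%E.
Proof.
move=> /ereal_inf_lt[_ [V FV <-] Vc]; apply: filterS FV => x Vx.
by apply: le_lt_trans Vc; apply: ereal_sup_ubound; exists x.
Qed.

Lemma limf_esup_ge {FF : ProperFilter F} c :
  (\forall x \near F, (c <= f x)%E) -> (c <= limf_esup f F)%E.
Proof.
move=> Fc; rewrite leNgt; apply/negP => /near_lt_limf_esup h.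
by have [x [] ] := filter_ex (filterI Fc h); rewrite leNgt => /negP.
Qed.

End limf_esup.

Section convexity.
Context {R : realType} {n : nat}.
Implicit Types (X : set 'rV[R]_n) (f : 'rV[R]_n -> R) (x y : 'rV[R]_n).

Lemma convex_set_segment X x y (t : R) : convex_set X -> X x -> X y ->
  0 <= t -> t <= 1 -> X (t *: x + (1 - t) *: y).
Proof.
move=> Xc Xx Xy t0 t1.
by have := Xc x y (Itv01 t0 t1); rewrite !inE; exact.
Qed.

Lemma convex_function_segment X f x y (t : R) : convex_function X f ->
  X x -> X y -> 0 <= t -> t <= 1 ->
  f (t *: x + (1 - t) *: y) <= t * f x + (1 - t) * f y.
Proof.
by move=> fc Xx Xy t0 t1; have := fc (Itv01 t0 t1) x y; rewrite !inE; exact.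
Qed.

Lemma segment_convex_set X :
  (forall x y (t : R), X x -> X y -> 0 <= t -> t <= 1 ->
    X (t *: x + (1 - t) *: y)) -> convex_set X.
Proof.
by move=> h x y t /set_mem Xx /set_mem Xy; apply/mem_set/h.
Qed.

Lemma segment_convex_function X f :
  (forall x y (t : R), X x -> X y -> 0 <= t -> t <= 1 ->
    f (t *: x + (1 - t) *: y) <= t * f x + (1 - t) * f y) ->
  convex_function X f.
Proof. by move=> h t x y /set_mem Xx /set_mem Xy; apply: h. Qed.

End convexity.

Section clarke.
Context {R : realType} {n : nat} (theta : 'rV[R]_n -> R) (z : 'rV[R]_n).
Implicit Types (v w a b : 'rV[R]_n).

Local Notation Fz := (filter_prod (nbhs z) (0 : R)^'+).
Local Notation dquot v p := ((theta (p.1 + p.2 *: v) - theta p.1) / p.2).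
Local Notation dd v := (fine (clarke_dd theta z v)).

(** This is the body of [locally_lipschitz_on] at one point, so that hypothesis supplies it by
    conversion. *)
Definition lipschitz_near := exists L : R,
  \forall y \near z & w \near z, `|theta y - theta w| <= L * enorm (y - w).

Hypothesis lip : lipschitz_near.

Lemma cvg_shift v : p.1 + p.2 *: v @[p --> Fz] --> z.
Proof.
have h1 : p.1 @[p --> Fz] --> z by exact: cvg_fst.
have h2 : p.2 @[p --> Fz] --> (0 : R^o).
  by apply: cvg_trans; [exact: cvg_snd|exact: cvg_within].
have := cvgD h1 (cvgZr_tmp (a := v) h2).
by rewrite scale0r addr0; apply.
Qed.

Lemma near_snd_gt0 : \forall p \near Fz, 0 < p.2.
Proof. exact: (cvg_snd (nbhs_right_gt 0)). Qed.

Lemma near_dquot_bounded v : exists C : R, \forall p \near Fz, `|dquot v p| <= C.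
Proof.
have [L hL] := lip; exists (L * enorm v).
have c2 : (p.1 + p.2 *: v, p.1) @[p --> Fz] --> filter_prod (nbhs z) (nbhs z).
  exact: (cvg_pair (cvg_shift v) cvg_fst).
have := c2 _ hL; have := near_snd_gt0.
apply: filterS2 => -[y t] /= t0.
rewrite [y + _]addrC addrK enormZ normrM normfV (gtr0_norm t0) mulrCA => h.
by rewrite ler_pdivrMr // mulrC.
Qed.

(** The Lipschitz constant bounds the difference quotients near [z], so the limsup is finite and
    [fine] loses nothing. *)
Lemma clarke_dd_fin v : clarke_dd theta z v = (dd v)%:E.
Proof.
have [C hC] := near_dquot_bounded v.
rewrite fineK // fin_numE -ltNye -ltey; apply/andP; split.
  apply: (@lt_le_trans _ _ (- C)%:E); first exact: ltNyr.
  apply: limf_esup_ge; apply: filterS hC => p /=; rewrite lee_fin.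
  by rewrite ler_norml => /andP[].
apply: (@le_lt_trans _ _ C%:E); last exact: ltry.
apply: limf_esup_le; apply: filterS hC => p /=; rewrite lee_fin.
by rewrite ler_norml => /andP[].
Qed.

Lemma clarke_dd_le v (c : R) : (\forall p \near Fz, dquot v p <= c) -> dd v <= c.
Proof.
move=> h; rewrite -lee_fin -clarke_dd_fin; apply: limf_esup_le.
by apply: filterS h => p; rewrite lee_fin.
Qed.

Lemma near_lt_clarke_dd v (c : R) : dd v < c -> \forall p \near Fz, dquot v p < c.
Proof.
rewrite -lte_fin -clarke_dd_fin => /near_lt_limf_esup.
by apply: filterS => p; rewrite lte_fin.
Qed.

(** Homogeneity is the change of step [t] to [s * t]. For subadditivity the quotient along [v + w]
    splits at [y + t *: w], a base point that also tends to [z]. *)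
Lemma sublinear_clarke_dd : sublinear (fun v => dd v).
Proof.
split=> [s v|v w].
  rewrite le_eqVlt => /predU1P[<-|s0].
    apply: clarke_dd_le; apply: filterS filterT => p _.
    by rewrite scale0r scaler0 addr0 subrr !mul0r.
  apply/ler_addgt0Pr => e e0; apply: clarke_dd_le.
  have : \forall p \near Fz, dquot v (p.1, s * p.2) < dd v + e / s.
    have c : (p.1, s * p.2) @[p --> Fz] --> Fz.
      have c0 : s * t @[t --> (0 : R)^'+] --> (0 : R)^'+.
        move=> A [r /= r0 rA]; exists (r / s) => /=; first exact: divr_gt0.
        move=> t /=; rewrite !sub0r !normrN ltr_pdivlMr // => tr t0.
        apply: rA => /=; last exact: mulr_gt0.
        by rewrite sub0r normrN normrM (gtr0_norm s0) mulrC.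
      exact: (cvg_pair cvg_fst (cvg_comp _ _ cvg_snd c0)).
    by apply: (c _ (near_lt_clarke_dd _)); rewrite ltrDl divr_gt0.
  have sn0 : s != 0 by rewrite gt_eqF.
  apply: filterS => -[y t] /=; rewrite scalerA [t * s]mulrC => h.
  rewrite -(@ler_pM2l _ s^-1) ?invr_gt0 //; apply: ltW; move: h.
  by rewrite mulrDr mulKf // invfM mulrCA (mulrC _ e).
apply/ler_addgt0Pr => e e0; apply: clarke_dd_le.
have : \forall p \near Fz, dquot v (p.1 + p.2 *: w, p.2) < dd v + e / 2.
  have c : (p.1 + p.2 *: w, p.2) @[p --> Fz] --> Fz.
    exact: (cvg_pair (cvg_shift w) cvg_snd).
  by apply: (c _ (near_lt_clarke_dd _)); rewrite ltrDl divr_gt0.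
have : \forall p \near Fz, dquot w p < dd w + e / 2.
  by apply: near_lt_clarke_dd; rewrite ltrDl divr_gt0.
apply: filterS2 => -[y t] /= h1 h2.
have -> : y + t *: (v + w) = y + t *: w + t *: v by rewrite scalerDr addrA addrAC.
by rewrite -(subrKA (theta (y + t *: w))) mulrDl; lra.
Qed.

Lemma clarke_dd_ge v (c C : R) :
  (forall s, 0 < s -> s <= 1 -> theta z + s * c <= theta (z + s *: v) + s ^+ 2 * C) ->
  c <= dd v.
Proof.
move=> h; rewrite leNgt; apply/negP => lt_c.
(* Half the gap: quotients based at [z] itself are eventually below [c - e], while the quadratic
   error, divided by [t], drops below [e]. *)
pose e := (c - dd v) / 2.
have e0 : 0 < e by rewrite divr_gt0 // subr_gt0.
have /near_lt_clarke_dd : dd v < c - e by rewrite /e; lra.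
have cz : (z, t) @[t --> (0 : R)^'+] --> Fz.
  exact: (cvg_pair (cvg_cst z) cvg_id).
move=> /cz; rewrite /= => h1.
have {}h1 : \forall t \near (0 : R)^'+, dquot v (z, t) < c - e by exact: h1.
have : \forall t \near (0 : R)^'+, t * C < e.
  have : t * C @[t --> (0 : R)^'+] --> 0 * C.
    by apply: cvgM; [exact: cvg_within|exact: cvg_cst].
  by rewrite mul0r => /cvgr_lt; exact.
move=> h2.
have h3 : \forall t \near (0 : R)^'+, t <= 1 by exact: nbhs_right_le.
have h4 : \forall t \near (0 : R)^'+, 0 < t by exact: nbhs_right_gt.
have [t [[/= k1 k2] [k3 k4]]] := filter_ex (filterI (filterI h1 h2) (filterI h3 h4)).
have := h _ k4 k3; rewrite leNgt => /negP; apply.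
move: k1; rewrite /= ltr_pdivrMr // => k1.
have : t * (t * C) < t * e by rewrite ltr_pM2l.
by rewrite expr2 -mulrA; lra.
Qed.

(** The hypothesis puts [dot b] below the Clarke derivative on the cone [T] of feasible directions.
    A linear [a] below the minorant [q] is then a Clarke subgradient, and
    [dot a (- d) <= q (- d) <= - dot b d] on [T] makes [b - a] normal. *)
Lemma clarke_fermat (X : set 'rV[R]_n) b : convex_set X -> X z ->
  (forall y, X y -> exists C, forall s, 0 < s -> s <= 1 ->
     theta z + s * dot b (y - z) <= theta (z + s *: (y - z)) + s ^+ 2 * C) ->
  clarke_normal_sum X theta z b.
Proof.
move=> Xconv Xz h.
have sdd := sublinear_clarke_dd.
pose T := [set l *: (y - z) | l in [set l : R | 0 <= l] & y in X].
have cT : convex_cone T.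
  split.
  - by exists 0; rewrite /= ?lexx //; exists z; rewrite // subrr scaler0.
  - move=> s _ s0 [l /= l0 [y Xy <-]]; exists (s * l); first exact: mulr_ge0.
    by exists y => //; rewrite scalerA.
  move=> _ _ [l /= l0 [y Xy <-]] [m /= m0 [w Xw <-]].
  exists (l + m); first exact: addr_ge0.
  have [lm0|lm0] := eqVneq (l + m) 0.
    exists z => //; rewrite lm0 scale0r.
    have [-> ->] : l = 0 /\ m = 0 by split; lra.
    by rewrite !scale0r addr0.
  have lm : 0 < l + m by rewrite lt_def lm0 addr_ge0.
  exists (l / (l + m) *: y + (1 - l / (l + m)) *: w).
    apply: convex_set_segment => //; first by rewrite divr_ge0 // ltW.
    by rewrite ler_pdivrMr // mul1r lerDl.
  apply/rowP => i; rewrite !mxE; field.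
  by rewrite lm0.
have [|q [sq qdd qT]] := @sublinear_below_cone _ _ _ T b sdd cT.
  move=> _ [l /= l0 [y Xy <-]]; rewrite dotZr.
  have [C hC] := h y Xy; have ge := clarke_dd_ge hC.
  have [->|ln0] := eqVneq l 0; first by rewrite scale0r mul0r (sublinear0 sdd).
  have lgt : 0 < l by rewrite lt_def ln0.
  rewrite -ler_pdivlMl //; apply: (le_trans ge).
  have := sdd.1 l^-1 (l *: (y - z)); rewrite scalerA mulVf // scale1r; apply.
  by rewrite invr_ge0.
have [a aq] := dot_below_sublinear sq.
exists a; last exists (b - a); last by rewrite addrC subrK.
  by move=> v; rewrite clarke_dd_fin lee_fin; apply: le_trans (qdd v).
move=> y Xy; rewrite dotDl dotNl.
have Ty : T (y - z) by exists 1 => //=; exists y => //; rewrite scale1r.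
have := aq (- (y - z)); have := qT _ Ty; rewrite dotNr; lra.
Qed.

End clarke.

(** * Convex functions and relative interior *)

Section convex_lipschitz.
Context {R : realType} {n : nat}.
Implicit Types (D X : set 'rV[R]_n) (F theta : 'rV[R]_n -> R) (x y z a : 'rV[R]_n).

Lemma lipschitz_near_ge0 F z : lipschitz_near F z -> exists2 L : R, 0 <= L &
  \forall y \near z & w \near z, `|F y - F w| <= L * enorm (y - w).
Proof.
move=> [L hL]; exists `|L| => //; apply: filterS hL => -[y w] /= /le_trans.
by apply; rewrite ler_wpM2r ?enorm_ge0 // ler_norm.
Qed.

Lemma near_lipschitz F z (L : R) :
  (\forall y \near z & w \near z, `|F y - F w| <= L * enorm (y - w)) ->
  \forall y \near z, `|F y - F z| <= L * enorm (y - z).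
Proof.
have c : (y, z) @[y --> z] --> filter_prod (nbhs z) (nbhs z).
  have h := cvg_pair (@cvg_id _ (nbhs z)) (@cvg_cst _ z _ (nbhs z) _). exact: h.
by move=> h; exact: (c _ h).
Qed.

Lemma lipschitz_near_continuous F z : lipschitz_near F z ->
  {for z, continuous (F : 'rV[R]_n -> R^o)}.
Proof.
move=> /lipschitz_near_ge0[L L0 /near_lipschitz hL].
apply/(@cvgrPdist_le R R^o _ (nbhs z)) => e e0; near=> y.
rewrite distrC; apply: (@le_trans _ _ (L * enorm (y - z))); first by near: y.
apply: (@le_trans _ _ (L * (e / (L + 1)))).
  rewrite ler_wpM2l // ltW //; near: y; apply: near_enorm_lt.
  by rewrite divr_gt0 // ltr_wpDl.
rewrite mulrCA ler_piMr ?(ltW e0) // ler_pdivrMr ?ltr_wpDl //.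
by rewrite mul1r lerDl.
Unshelve. all: by end_near. Qed.

Local Notation Fz z := (filter_prod (nbhs z) (0 : R)^'+).

(** Difference quotients of a convex function increase with the step, so those at [(x, t)] are
    bounded by the one at a fixed step [s >= t]. The Lipschitz bound moves its base point from [x]
    to [z], where convexity compares it with [F y - F z]. *)
Lemma clarke_subdiff_convex D F z a : convex_function D F ->
  (\forall y \near z, D y) -> lipschitz_near F z -> clarke_subdiff F z a ->
  forall y, D y -> F z + dot a (y - z) <= F y.
Proof.
move=> Fconv nD lip az y Dy; rewrite -lerBrDl.
have := az (y - z); rewrite clarke_dd_fin // lee_fin => /le_trans; apply.
set v := y - z.
have [L L0 hL] := lipschitz_near_ge0 lip.
apply/ler_addgt0Pr => e e0; apply: clarke_dd_le => //.
have c1 : (p.1 + p.2 *: v, z + p.2 *: v) @[p --> (Fz z)] --> filter_prod (nbhs z) (nbhs z).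
  have h1 : p.2 @[p --> (Fz z)] --> (0 : R^o).
    by apply: cvg_trans; [exact: cvg_snd|exact: cvg_within].
  have h2 : z + p.2 *: v @[p --> (Fz z)] --> z.
    have := cvgD (cvg_cst z) (cvgZr_tmp (a := v) h1).
    by rewrite scale0r addr0; apply.
  exact: (cvg_pair (cvg_shift v) h2).
have [[A B] [/= Az B0] AB] :
    (Fz z) [set p | `|F (p.1 + p.2 *: v) - F (z + p.2 *: v)| <= L * enorm (p.1 - z)
             /\ D (p.1 + p.2 *: v)].
  have n1 : \forall p \near Fz z, `|F (p.1 + p.2 *: v) - F (z + p.2 *: v)| <=
      L * enorm (p.1 + p.2 *: v - (z + p.2 *: v)) by exact: (c1 _ hL).
  have n2 : \forall p \near Fz z, D (p.1 + p.2 *: v) by exact: (cvg_shift v nD).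
  apply: filterS2 n2 n1 => -[y' s] /= h1; rewrite opprD addrACA subrr addr0 => h2.
  by split.
have [s [Bs [s0 s1]]] : exists s, B s /\ (0 < s /\ s <= 1).
  have h3 : \forall t \near (0 : R)^'+, t <= 1 by exact: nbhs_right_le.
  have h4 : \forall t \near (0 : R)^'+, 0 < t by exact: nbhs_right_gt.
  by have [s] := filter_ex (filterI B0 (filterI h4 h3)); exists s.
(* With [s] fixed, base points are taken so close to [z] that replacing [x] by [z] in the quotient
   of step [s] costs at most [e], that is [2 L |x - z| <= e s]. *)
exists ([set x | [/\ A x, D x, `|F x - F z| <= L * enorm (x - z) &
          enorm (x - z) < e * s / (2 * (L + 1))]], [set t | 0 < t /\ t <= s]).
  split => /=; last first.
    apply: filterI; first exact: nbhs_right_gt.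
    exact: nbhs_right_le.
  have h := near_lipschitz hL.
  have h' : \forall x \near z, enorm (x - z) < e * s / (2 * (L + 1)).
    by apply: near_enorm_lt; rewrite divr_gt0 ?mulr_gt0 // ltr_wpDl.
  by apply: filterS (filterI (filterI Az nD) (filterI h h')) => x [[? ?] [? ?]]; split.
move=> [x t] [/= [Ax Dx hx dx] [t0 ts]].
have [hxs Dxs] := AB (x, s) (conj Ax Bs).
have sn0 : s != 0 by rewrite gt_eqF.
have E1 : x + t *: v = t / s *: (x + s *: v) + (1 - t / s) *: x.
  by apply/rowP => i; rewrite !mxE; field.
have E2 : z + s *: v = s *: y + (1 - s) *: z.
  by apply/rowP => i; rewrite !mxE; ring.
have k1 : F (x + t *: v) <= t / s * F (x + s *: v) + (1 - t / s) * F x.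
  rewrite E1; apply: (convex_function_segment Fconv) => //.
    by rewrite divr_ge0 // ltW.
  by rewrite ler_pdivrMr // mul1r.
have Dz : D z by exact: nbhs_singleton nD.
have k2 : F (z + s *: v) <= s * F y + (1 - s) * F z.
  by rewrite E2; apply: (convex_function_segment Fconv) => //; exact: ltW.
have k3 : 2 * (L * enorm (x - z)) <= e * s.
  move: dx; rewrite ltr_pdivlMr ?mulr_gt0 ?ltr_wpDl // => dx.
  by have := enorm_ge0 (x - z); lra.
move: hx hxs; rewrite !ler_norml /= => /andP[hx1 hx2] /andP[hx3 hx4].
rewrite ler_pdivrMr //.
apply: (@le_trans _ _ (t / s * (F (x + s *: v) - F x))); first by lra.
have -> : (F y - F z + e) * t = t / s * ((F y - F z + e) * s) by field.
have ts0 : 0 <= t / s by rewrite divr_ge0 // ltW.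
rewrite ler_wpM2l //; lra.
Qed.

Lemma convex_lipschitz_near D F z (r M : R) : convex_function D F -> 0 < r ->
  (forall y, enorm (y - z) <= r -> D y) -> (forall y, D y -> `|F y| <= M) ->
  lipschitz_near F z.
Proof.
move=> Fconv r0 ball_D FM; exists (4 * M / r).
have r4 : 0 < r / 4 by rewrite divr_gt0.
have half (y w : 'rV[R]_n) : enorm (y - z) < r / 4 -> enorm (w - z) < r / 4 ->
    F w - F y <= 4 * M / r * enorm (y - w).
  move=> yz wz.
  have [yw|yw] := eqVneq (enorm (y - w)) 0.
    move/enorm_eq0/eqP: (yw); rewrite subr_eq0 => /eqP ->.
    by rewrite !subrr enorm0 mulr0.
  (* The segment from [y] through [w] is prolonged to [x], at distance [r / 2] from [y] and still in
     the ball. Then [w] is the combination of [x] and [y] with weight [s] on [x], and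
     [F w - F y <= 2 M s]. *)
  pose s := enorm (y - w) / (r / 2).
  have r2 : 0 < r / 2 by rewrite divr_gt0.
  have s0 : 0 < s by rewrite divr_gt0 // lt_def yw enorm_ge0.
  have s1 : s <= 1.
    rewrite ler_pdivrMr // mul1r; apply: (le_trans (enorm_triangle z _ _)).
    by rewrite (enormB z); lra.
  pose x := y + s^-1 *: (w - y).
  have Dx : D x.
    apply: ball_D; rewrite /x addrAC; apply: (le_trans (enormD _ _)).
    rewrite enormZ gtr0_norm ?invr_gt0 // /s invf_div enormB.
    by rewrite (enormB w) divfK //; lra.
  have Dy : D y by apply: ball_D; lra.
  have E : w = s *: x + (1 - s) *: y.
    by apply/rowP => i; rewrite !mxE; field; rewrite gt_eqF.
  have := convex_function_segment Fconv Dx Dy (ltW s0) s1; rewrite -E.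
  have := FM _ Dx; have := FM _ Dy; rewrite !ler_norml => /andP[h1 h2] /andP[h3 h4].
  have -> : 4 * M / r * enorm (y - w) = s * (2 * M).
    by rewrite /s; field; rewrite gt_eqF.
  have : s * (F x - F y) <= s * (2 * M) by rewrite ler_pM2l //; lra.
  lra.
have nz : \forall y \near z, enorm (y - z) < r / 4 by exact: near_enorm_lt.
exists ([set y | enorm (y - z) < r / 4], [set y | enorm (y - z) < r / 4]) => //=.
move=> [y w] /= [yz wz]; rewrite ler_norml -lerNl opprB.
rewrite half //= -(enormN (y - w)) opprB; exact: half.
Qed.

(** Fermat's rule with [b] the negative gradient at [z] of the quadratic term; its second-order part
    is the allowed error. *)
Lemma prox_clarke_normal X theta x z (c : R) : convex_set X ->
  lipschitz_near theta z ->
  argmin X (fun y => theta y + c * enorm (y - x) ^+ 2) z ->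
  clarke_normal_sum X theta z (- (2 * c) *: (z - x)).
Proof.
move=> Xc lip [Xz zmin]; apply: clarke_fermat => // y Xy.
exists (c * enorm (y - z) ^+ 2) => s s0 s1.
have Xs : X (z + s *: (y - z)).
  have -> : z + s *: (y - z) = s *: y + (1 - s) *: z.
    by apply/rowP => i; rewrite !mxE; ring.
  by apply: convex_set_segment => //; exact: ltW.
have := zmin _ Xs; rewrite dotZl [z + _ - x]addrAC sqr_enormDZ.
lra.
Qed.

End convex_lipschitz.

(** * Relative interior of a convex set *)

Section relative_interior.
Context {R : realType} {n : nat}.
Implicit Types (X : set 'rV[R]_n) (x y e : 'rV[R]_n).

(** The missing weight sits on [x]. Induction peels off one point and rescales the other weights by
    [1 - c i], which is positive because the total is strictly below [1]. *)
Lemma convex_set_comb X x (I : Type) (s : seq I) (c : I -> R) (b : I -> 'rV[R]_n) :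
  convex_set X -> X x -> (forall i, X (x + b i)) -> (forall i, 0 <= c i) ->
  \sum_(i <- s) c i < 1 -> X (x + \sum_(i <- s) c i *: b i).
Proof.
move=> Xc Xx Xb; elim: s c => [|i s IH] c c0; first by rewrite !big_nil addr0.
rewrite !big_cons => lt1.
have ge0 : 0 <= \sum_(j <- s) c j by exact: sumr_ge0.
have ci1 : 0 < 1 - c i by lra.
have := IH (fun j => c j / (1 - c i)).
rewrite -mulr_suml ltr_pdivrMr // mul1r => h.
have {}h : X (x + \sum_(j <- s) (c j / (1 - c i)) *: b j).
  by apply: h => [j|]; [rewrite divr_ge0 // ltW|lra].
have := convex_set_segment Xc (Xb i) h (c0 i).
have -> : \sum_(j <- s) (c j / (1 - c i)) *: b j =
    (1 - c i)^-1 *: \sum_(j <- s) c j *: b j.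
  by rewrite scaler_sumr; apply: eq_bigr => j _; rewrite scalerA mulrC.
move: (\sum_(j <- s) c j *: b j) => S XS.
have -> : x + (c i *: b i + S) =
    c i *: (x + b i) + (1 - c i) *: (x + (1 - c i)^-1 *: S).
  by apply/rowP => j; rewrite !mxE; field; rewrite gt_eqF.
by apply: XS; lra.
Qed.

(* [x + 'rV_n *m P] is the affine hull of [X]. *)
Lemma convex_set_relint X x : convex_set X -> X x ->
  exists (P : 'M[R]_n) u (r : R), [/\ X u, 0 < r,
    forall y, X y -> (y - x) *m P = y - x &
    forall e, enorm e <= r -> X (u + e *m P)].
Proof.
move=> Xc Xx.
(* A maximal independent family of differences with [x] spans all of them, since an independent one
   could be appended. *)
pose indep k := `[< exists B : 'M[R]_(k, n), row_free B /\ forall i, X (x + row i B) >].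
have indep0 : exists k, indep k.
  exists 0%N; apply/asboolP; exists 0; split; last by case.
  by rewrite /row_free mxrank0.
have indep_le k : indep k -> (k <= n)%N.
  by move=> /asboolP[B [Bfree _]]; rewrite -(eqP Bfree) rank_leq_col.
have [k /asboolP[B [Bfree BX]] kmax] := ex_maxnP indep0 indep_le.
have sub_B y : X y -> (y - x <= B)%MS.
  move=> Xy; apply/negPn/negP => yB.
  suff : (k + 1 <= k)%N by rewrite addn1 ltnn.
  apply: kmax; apply/asboolP; exists (col_mx B (y - x)); split.
    have kE : (k + 1 = (\rank B).+1)%N by rewrite (eqP Bfree) addn1.
    rewrite /row_free eqn_leq rank_leq_row /= [X in (X <= _)%N]kE -addsmxE.
    apply: rank_ltmx; rewrite ltmxE addsmxSl; apply: contra yB.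
    exact: submx_trans (addsmxSr _ _).
  move=> i; case: (split_ordP i) => j ->.
    by rewrite rowKu.
  by rewrite rowKd row_id addrCA subrr addr0.
pose G : 'M[R]_(n, k) := pinvmx B.
(* Equal weights [q] on [x] and on the [k] points [x + row i B] define the center [u]; the weight
   left for [x] is [1 - k q = q]. *)
pose q : R := k.+1%:R^-1.
have q0 : 0 < q by rewrite invr_gt0.
(* [C] dominates the norm of every column of [G], so [|e| <= q^2 / C] changes each weight by at most
   [q^2 <= q]. *)
pose C : R := 1 + \sum_(i < k) enorm (col i G)^T.
have C1 : 1 <= C by rewrite lerDl sumr_ge0 // => i _; exact: enorm_ge0.
have C0 : 0 < C by apply: lt_le_trans C1.
pose c e (i : 'I_k) := q + (e *m G) 0 i.
have cE e : x + \sum_i q *: row i B + e *m (G *m B) = x + \sum_i c e i *: row i B.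
  rewrite mulmxA [e *m G *m B]mulmx_sum_row -addrA -big_split /=.
  by congr (_ + _); apply: eq_bigr => i _; rewrite scalerDl.
have cX e : enorm e <= q ^+ 2 / C ->
    X (x + \sum_i q *: row i B + e *m (G *m B)).
  move=> er; rewrite cE.
  have cle i : `|(e *m G) 0 i| <= q ^+ 2.
    have -> : (e *m G) 0 i = dot e (col i G)^T.
      by rewrite mxE; apply: eq_bigr => j _; rewrite !mxE.
    apply: (le_trans (normr_dot_le _ _)).
    move: er; rewrite ler_pdivlMr //; apply: le_trans.
    rewrite ler_wpM2l ?enorm_ge0 // /C (bigD1 i) //= addrCA lerDl.
    by rewrite addr_ge0 // sumr_ge0 // => j _; exact: enorm_ge0.
  have q1 : q <= 1 by rewrite invf_le1 // ler1n.
  have qk : q * k.+1%:R = 1 by rewrite mulVf.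
  apply: convex_set_comb => // [i|].
    have := cle i; rewrite ler_norml => /andP[h _].
    have : q * q <= q * 1 by rewrite ler_pM2l.
    by rewrite /c -expr2; lra.
  (* As [k q = 1 - q], this sum equals [(1 - q) (1 + q) = 1 - q^2 < 1]. *)
  apply: (@le_lt_trans _ _ (\sum_(i < k) (q + q ^+ 2))).
    apply: ler_sum => i _; rewrite lerD2l.
    by have := cle i; rewrite ler_norml => /andP[].
  rewrite sumr_const card_ord -[X in X < _]mulr_natr.
  move: qk; rewrite -natr1 mulrDr mulr1 => qk.
  have -> : (q + q ^+ 2) * k%:R = q * k%:R * (1 + q) by ring.
  have -> : q * k%:R = 1 - q by lra.
  have : 0 < q ^+ 2 by rewrite exprn_gt0.
  by rewrite expr2; lra.
exists (G *m B), (x + \sum_i q *: row i B), (q ^+ 2 / C); split=> //.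
- have := cX 0; rewrite mul0mx addr0; apply.
  by rewrite enorm0 divr_ge0 ?exprn_ge0 ?ltW.
- by rewrite divr_gt0 ?exprn_gt0.
- by move=> y /sub_B yB; rewrite mulmxA mulmxKpV.
Qed.

End relative_interior.

(** * Existence of proximal points *)

Section prox_existence.
Context {R : realType} {n : nat}.
Implicit Types (X : set 'rV[R]_n) (f theta : 'rV[R]_n -> R) (x y w u a : 'rV[R]_n).

Lemma compact_enorm_diameter X x : compact X -> X x ->
  exists2 d : R, 0 <= d & forall y w, X y -> X w -> enorm (y - w) <= d.
Proof.
move=> Xc Xx; have X0 : X !=set0 by exists x.
have cX : {within X, continuous (fun y => enorm (y - x) : R^o)}.
  by apply: continuous_subspaceT; exact: continuous_enormB.
have [w wX wmax] := compact_EVT_max X0 Xc cX.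
exists (2 * enorm (w - x)); first by rewrite mulr_ge0 // enorm_ge0.
move=> y v Xy Xv; apply: (le_trans (enorm_triangle x _ _)).
rewrite (enormB x).
by have := wmax y (mem_set Xy); have := wmax v (mem_set Xv); lra.
Qed.

Lemma continuous_prox_term x (c : R) :
  continuous (fun y => c * enorm (y - x) ^+ 2 : R^o).
Proof.
move=> y; have h : {for enorm (y - x), continuous (fun s : R => c * s ^+ 2 : R^o)}.
  apply: continuousM; first exact: cst_continuous.
  exact: exprn_continuous.
exact: (continuous_comp (continuous_enormB (z := x) (x := y)) h).
Qed.

Lemma prox_argmin_exists X theta x (c : R) : compact X -> X !=set0 ->
  (forall y, X y -> lipschitz_near theta y) ->
  exists z, argmin X (fun y => theta y + c * enorm (y - x) ^+ 2) z.
Proof.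
move=> Xc X0 lip.
have cont : {within X, continuous
    (fun y => theta y + c * enorm (y - x) ^+ 2 : R^o)}.
  apply: continuous_in_subspaceT => y /set_mem Xy.
  have c1 := lipschitz_near_continuous (lip y Xy).
  exact: (continuousD c1 (@continuous_prox_term x c y)).
have [z zX zmin] := compact_EVT_min X0 Xc cont.
by exists z; split=> [|y Xy]; [exact: set_mem|exact/zmin/mem_set].
Qed.

Lemma continuous_affine u (s : R) : continuous (fun w => u + s *: w).
Proof.
move=> w; apply: continuousD; first exact: cst_continuous.
by apply: continuousZl_tmp => A.
Qed.

(* [f] is minimized over a copy of [X] shrunk towards the relative interior
   point [u]: a subgradient exists at the minimizer, and testing the subgradient
   inequality around [u] bounds it independently of the shrinking factor. *)
Lemma shrunk_prox_subgradient X f x (c M : R) :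
  compact X -> convex_set X -> convex_function X f -> X x ->
  (forall y, X y -> `|f y| <= M) -> 0 <= c ->
  exists u (K : R), X u /\ forall t : R, 0 < t -> t < 1 ->
    exists a y, [/\ convex_subdiff X f y a, forall i, `|a 0 i| <= K &
      forall w, X w ->
        f y + c * enorm (y - x) ^+ 2 <=
        f (t *: u + (1 - t) *: w) +
          c * enorm (t *: u + (1 - t) *: w - x) ^+ 2].
Proof.
move=> Xc Xconv fconv Xx fM c0.
have [d d0 Xd] := compact_enorm_diameter Xc Xx.
have [P [u [r [Xu r0 XP ball_u]]]] := convex_set_relint Xconv Xx.
(* [X] may have empty interior, whereas Clarke subgradients look at a full neighborhood. Composition
   with the affine map [A], which fixes [X], extends [f] to [D], a neighborhood of each point of the
   shrunk copy [Y]. *)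
pose A y := x + (y - x) *m P.
pose F y := f (A y).
pose D := [set y | X (A y)].
have AX y : X y -> A y = y by move=> Xy; rewrite /A XP // addrC subrK.
have Aconv (s : R) y w : A (s *: y + (1 - s) *: w) = s *: A y + (1 - s) *: A w.
  rewrite /A; have -> : s *: y + (1 - s) *: w - x = s *: (y - x) + (1 - s) *: (w - x).
    by apply/rowP => i; rewrite !mxE; ring.
  rewrite mulmxDl -!scalemxAl.
  move: (_ *m P) (_ *m P) => v1 v2.
  by apply/rowP => i; rewrite !mxE; ring.
have AD y e : A (y + e) = A y + e *m P by rewrite /A addrAC mulmxDl addrA.
have Fconv : convex_function D F.
  apply: segment_convex_function => y w s Dy Dw s0 s1.
  by rewrite /F Aconv; exact: convex_function_segment.
have FM y : D y -> `|F y| <= M by exact: fM.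
have FX y : X y -> F y = f y by move=> Xy; rewrite /F AX.
have XD y : X y -> D y by move=> Xy; rewrite /D /= AX.
exists u, ((2 * M + 2 * c * d * d) / r); split=> // t t0 t1.
pose Y := [set t *: u + (1 - t) *: w | w in X].
have YX y : Y y -> X y.
  by move=> [w Xw <-]; apply: convex_set_segment => //; exact: ltW.
have ballD y e : Y y -> enorm e <= t * r -> D (y + e).
  move=> [w Xw <-] er; rewrite /D /= AD.
  (* The perturbation is charged to [u]: divided by [t], it has norm at most [r] and keeps [u]
     inside [X]. *)
  have -> : A (t *: u + (1 - t) *: w) + e *m P =
      t *: (u + (t^-1 *: e) *m P) + (1 - t) *: w.
    rewrite Aconv !AX // -scalemxAl; move: (e *m P) => v.
    by apply/rowP => i; rewrite !mxE; field; rewrite gt_eqF.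
  apply: convex_set_segment => //; [|exact: ltW|exact: ltW].
  by apply: ball_u; rewrite enormZ gtr0_norm ?invr_gt0 // ler_pdivrMl.
have lipF y : Y y -> lipschitz_near F y.
  move=> Yy; apply: (@convex_lipschitz_near _ _ _ _ _ (t * r) M Fconv) => //.
    exact: mulr_gt0.
  by move=> w wy; rewrite -(subrK y w) addrC; exact: ballD.
have Yc : compact Y.
  apply: continuous_compact => //; apply: continuous_subspaceT; exact: continuous_affine.
have Yconv : convex_set Y.
  apply: segment_convex_set => _ _ s [y Xy <-] [w Xw <-] s0 s1.
  exists (s *: y + (1 - s) *: w); first exact: convex_set_segment.
  by apply/rowP => i; rewrite !mxE; ring.
have Yu : Y u by exists u => //; apply/rowP => i; rewrite !mxE; ring.
have [y ymin] := @prox_argmin_exists Y F x c Yc (ex_intro _ u Yu) lipF.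
have Yy := ymin.1.
have [a ay [v vy abE]] := prox_clarke_normal Yconv (lipF _ Yy) ymin.
have nD : \forall w \near y, D w.
  apply: filterS (near_enorm_lt y (mulr_gt0 t0 r0)) => w /ltW.
  by rewrite -{2}(subrK y w) (addrC _ y); exact: ballD.
have sub := clarke_subdiff_convex Fconv nD (lipF _ Yy) ay.
exists a, y; split.
- split=> [|w Xw]; first exact: YX.
  by have := sub w (XD _ Xw); rewrite !FX //; exact: YX.
(* Normality of [v] tested at [u] gives [dot a (u - y) >= - 2 c d^2], and the subgradient inequality
   at [u + e] then bounds [dot a e]. *)
- have K1 e : enorm e <= r -> dot a e <= 2 * M + 2 * c * d * d.
    move=> er; have Du : D (u + e) by rewrite /D /= AD AX //; exact: ball_u.
    have := sub _ Du.
    rewrite addrAC dotDr.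
    have := vy _ Yu.
    have -> : v = - (2 * c) *: (y - x) - a by rewrite -abE addrC addrA addNr add0r.
    rewrite dotDl dotNl dotZl => h1 h2.
    have := FM _ Du; have := FM _ (XD _ (YX _ Yy)).
    rewrite !ler_norml => /andP[h3 h4] /andP[h5 h6].
    have h7 : dot (y - x) (u - y) <= d * d.
      apply: (le_trans (cauchy_schwarz _ _)).
      by apply: ler_pM; rewrite ?enorm_ge0 //; apply: Xd => //; exact: YX.
    have : c * dot (y - x) (u - y) <= c * (d * d) by rewrite ler_wpM2l.
    lra.
  move=> i; pose e := r *: delta_mx 0 i : 'rV[R]_n.
  have er : enorm e = r by rewrite enormZ enorm_delta mulr1 gtr0_norm.
  have ae : dot a e = a 0 i * r by rewrite dotZr dot_delta mulrC.
  rewrite ler_norml lerNl !ler_pdivlMr // mulNr -ae -dotNr.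
  by rewrite !K1 ?enormN ?er.
- move=> w Xw; have Yw : Y (t *: u + (1 - t) *: w) by exists w.
  by have := ymin.2 _ Yw; rewrite !FX //; exact: YX.
Qed.

(** [f] may be discontinuous on the relative boundary, so [f (y k)] is not passed to the limit. The
    limit subgradient [a0] bounds it below by an affine function, and only continuous terms
    remain. *)
Lemma convex_prox_argmin_exists X f x (c M : R) :
  compact X -> convex_set X -> convex_function X f -> X x ->
  (forall y, X y -> `|f y| <= M) -> 0 <= c ->
  closed [set p : 'rV[R]_n * 'rV[R]_n | convex_subdiff X f p.2 p.1] ->
  exists y, argmin X (fun y => f y + c * enorm (y - x) ^+ 2) y.
Proof.
move=> Xc Xconv fconv Xx fM c0 fclosed.
have [u [K [Xu hu]]] := shrunk_prox_subgradient Xc Xconv fconv Xx fM c0.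
(* The offset [2] keeps [t k < 1] already at [k = 0]. *)
pose t (k : nat) : R := k.+2%:R^-1.
have t0 k : 0 < t k by rewrite invr_gt0.
have t1 k : t k < 1 by rewrite invf_lt1 // ltr1n.
have /choice[a] := fun k => hu (t k) (t0 k) (t1 k).
move=> /choice[y hay].
pose B := [set a : 'rV[R]_n | forall i, `[- K, K]%classic (a ord0 i)].
have Bc : compact (B `*` X).
  apply: compact_setX => //.
  exact: (rV_compact (fun=> @segment_compact _ _ _)).
pose p k := (a k, y k).
have pB : (p @ \oo) (B `*` X).
  have : \forall k \near \oo, (B `*` X) (p k); last exact.
  apply: nearW => k; have [[Xy _] aK _] := hay k.
  split => // i; change (a k 0 i \in `[- K, K]).
  by rewrite in_itv /= -ler_norml.
have [[a0 y0] [[_ Xy0] cl]] := Bc _ _ pB.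
have [_ sub0] : convex_subdiff X f y0 a0.
  have : closure [set p : 'rV[R]_n * 'rV[R]_n | convex_subdiff X f p.2 p.1] (a0, y0).
    move=> N /cl; apply.
    have : \forall k \near \oo, convex_subdiff X f (p k).2 (p k).1; last exact.
    by apply: nearW => k; have [] := hay k.
  by move/fclosed.
exists y0; split => // w Xw.
pose Phi v := dot a0 v + c * enorm (v - x) ^+ 2.
(* Shrinking [w] towards [u] raises the objective by at most [t k] times [C]; the quadratic term
   enters through [t^2 <= t]. *)
pose C := f u - f w + c * (2 * dot (w - x) (u - w) + enorm (u - w) ^+ 2).
have up k : f y0 - dot a0 y0 + Phi (y k) <= f w + c * enorm (w - x) ^+ 2 + t k * `|C|.
  have [[Xy _] _ /(_ w Xw)] := hay k.
  have := convex_function_segment fconv Xu Xw (ltW (t0 k)) (ltW (t1 k)).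
  have := sub0 _ Xy; rewrite dotDr dotNr.
  have -> : t k *: u + (1 - t k) *: w - x = (w - x) + t k *: (u - w).
    by apply/rowP => i; rewrite !mxE; ring.
  rewrite sqr_enormDZ => h1 h2 h3.
  have h4 : t k * C <= t k * `|C| by rewrite ler_pM2l // ler_norm.
  have h5 : t k * (t k * (c * enorm (u - w) ^+ 2)) <= t k * (1 * (c * enorm (u - w) ^+ 2)).
    rewrite ler_pM2l // ler_wpM2r // ?mulr_ge0 ?exprn_ge0 ?enorm_ge0 //.
    exact: ltW.
  rewrite /Phi; rewrite /C in h4 *.
  lra.
rewrite leNgt; apply/negP => lt.
(* Half the supposed gap: [Phi] exceeds [Phi y0 - e] near the cluster point, the error in [up] is
   eventually below [e], and a pair satisfying both closes the gap. *)
pose e := (f y0 + c * enorm (y0 - x) ^+ 2 - (f w + c * enorm (w - x) ^+ 2)) / 2.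
have e0 : 0 < e by rewrite divr_gt0 // subr_gt0.
have Nnbhs : nbhs (a0, y0) [set q : 'rV[R]_n * 'rV[R]_n | Phi y0 - e < Phi q.2].
  have cPhi : {for y0, continuous (Phi : 'rV[R]_n -> R^o)}.
    exact: (continuousD (@continuous_dotr _ _ a0 y0) (@continuous_prox_term x c y0)).
  have nPhi : \forall v \near y0, Phi y0 - e < Phi v.
    by apply: (cvgr_gt _ cPhi); rewrite ltrBlDr ltrDl.
  exists (setT, [set v | Phi y0 - e < Phi v]); last by move=> [? ?] [].
  by split => //=; exact: filterT.
have tail : (p @ \oo) [set q : 'rV[R]_n * 'rV[R]_n |
     f y0 - dot a0 y0 + Phi q.2 < f w + c * enorm (w - x) ^+ 2 + e].
  have C1 : 0 < `|C| + 1 by rewrite ltr_wpDl.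
  have eC : 0 < e / (`|C| + 1) by rewrite divr_gt0.
  have : \forall k \near \oo, f y0 - dot a0 y0 + Phi (p k).2 <
      f w + c * enorm (w - x) ^+ 2 + e; last exact.
  apply: filterS (near_infty_natSinv_lt (PosNum eC)) => k /= ltk.
  apply: (le_lt_trans (up k)); rewrite ltrD2l.
  have tk : t k < e / (`|C| + 1).
    apply: le_lt_trans ltk; rewrite lef_pV2 ?posrE //.
    by rewrite ler_nat.
  move: tk; rewrite ltr_pdivlMr // mulrDr mulr1.
  by have := t0 k; lra.
have [q [/= q1 q2]] := cl _ _ tail Nnbhs.
rewrite /e in q1 q2; rewrite /Phi in q2; rewrite /Phi in q1; lra.
Qed.

End prox_existence.

(** * Surrogate functions *)

Section surrogate.
Context {R : realType} {n : nat}.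
Implicit Types (X A : set 'rV[R]_n) (f theta : 'rV[R]_n -> R) (x y z : 'rV[R]_n).
Implicit Types (V : 'rV[R]_n -> 'rV[R]_n -> R) (rho : R).

Lemma edist_set_le x A y : A y -> (edist_set x A <= (enorm (x - y))%:E)%E.
Proof. by move=> Ay; apply: ereal_inf_lbound; exists y. Qed.

Lemma edist_set_triangle x z A :
  (edist_set x A <= (enorm (x - z))%:E + edist_set z A)%E.
Proof.
rewrite -leeBlDl //; apply: le_ereal_inf_tmp => _ [y Ay <-].
rewrite leeBlDl // -EFinD; apply: (le_trans (edist_set_le x Ay)).
by rewrite lee_fin enorm_triangle.
Qed.

Lemma lipschitz_compact_bounded X theta : compact X ->
  (forall y, X y -> lipschitz_near theta y) ->
  exists M : R, forall y, X y -> `|theta y| <= M.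
Proof.
move=> Xc lip; have [->|/set0P X0] := eqVneq X set0; first by exists 0.
have cX : {within X, continuous (theta : 'rV[R]_n -> R^o)}.
  apply: continuous_in_subspaceT => y /set_mem Xy.
  exact: lipschitz_near_continuous (lip y Xy).
have [a _ amin] := compact_EVT_min X0 Xc cX.
have [b _ bmax] := compact_EVT_max X0 Xc cX.
exists (`|theta a| + `|theta b|) => y Xy.
have := amin y (mem_set Xy); have := bmax y (mem_set Xy).
have := ler_norm (theta b); have := ler_norm (- theta a); rewrite normrN.
have := normr_ge0 (theta a); have := normr_ge0 (theta b).
by rewrite ler_norml; lra.
Qed.

(** Freezing the base point: the graph is the preimage of the closed set in (SR3) under [p] mapped
    to [(p, x)]. *)
Lemma SR3_closed X V x : SR3 X V -> X x ->
  closed [set p : 'rV[R]_n * 'rV[R]_n | convex_subdiff X (fun y => V y x) p.2 p.1].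
Proof.
move=> V3 Xx.
pose g (p : 'rV[R]_n * 'rV[R]_n) := (p, x).
have cg : continuous g.
  move=> p; exact: (cvg_pair cvg_id (cvg_cst x)).
rewrite (_ : [set p | _] = g @^-1` [set p |
    let: (a, y, x') := p in [/\ X y, X x' & convex_subdiff X (fun z => V z x') y a]]).
  by apply: (proj1 (continuous_closedP g) cg).
apply/seteqP; split => [[a y] /= [Xy h]|[a y] /= []] //.
Qed.

(** By (SR1) the surrogate lies between [theta] and [theta] plus a quadratic, hence is bounded on
    [X]. With the closed graph from (SR3) a minimizer exists, and [get] returns one. *)
Lemma prox_mapP X theta V rho x : compact X -> convex_set X ->
  locally_lipschitz_on X theta -> SR1 X theta V -> SR3 X V -> 0 < rho -> X x ->
  argmin X (fun y => prox_surrogate V rho y x) (prox_map X V rho x).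
Proof.
move=> Xc Xconv lip [Vconv _ V_ge [kappa k0 V_le]] V3 rho0 Xx; apply: getPex.
have [d d0 Xd] := compact_enorm_diameter Xc Xx.
have [M thetaM] := lipschitz_compact_bounded Xc lip.
apply: (@convex_prox_argmin_exists _ _ _ _ _ _ (M + kappa / 2 * d ^+ 2)) => //.
- exact: Vconv.
- move=> y Xy; have := thetaM y Xy; rewrite !ler_norml => /andP[h1 h2].
  have h3 := V_ge x y Xx Xy; have h4 := V_le x y Xx Xy.
  have : kappa / 2 * enorm (y - x) ^+ 2 <= kappa / 2 * d ^+ 2.
    rewrite ler_pM2l ?divr_gt0 // ler_pXn2r ?nnegrE ?enorm_ge0 //.
    exact: Xd.
  have : 0 <= kappa / 2 * enorm (y - x) ^+ 2.
    by rewrite mulr_ge0 ?divr_ge0 ?exprn_ge0 ?enorm_ge0 // ltW.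
  lra.
- by rewrite invr_ge0 mulr_ge0 // ltW.
- exact: SR3_closed.
Qed.

(** On the segment from [x] to [y] the quadratic term is of order [s^2] and convexity bounds the
    increase of [f] by [s (f y - f x)]; dividing by [s] leaves an arbitrarily small error. *)
Lemma prox_fixed_argmin X f x (c : R) : convex_set X -> convex_function X f ->
  0 <= c -> argmin X (fun y => f y + c * enorm (y - x) ^+ 2) x -> argmin X f x.
Proof.
move=> Xconv fconv c0 [Xx xmin]; split=> // y Xy.
apply/ler_addgt0Pr => e e0.
pose D := c * enorm (y - x) ^+ 2.
have D0 : 0 <= D by rewrite mulr_ge0 ?exprn_ge0 ?enorm_ge0.
(* This choice lies in [(0, 1]] and gives [s D <= e], also when [D = 0]. *)
pose s := e / (e + D).
have eD : 0 < e + D by rewrite ltr_wpDr.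
have s0 : 0 < s by rewrite divr_gt0.
have s1 : s <= 1 by rewrite ler_pdivrMr // mul1r lerDl.
have sD : s * D <= e by rewrite mulrAC ler_pdivrMr // ler_pM2l // lerDr ltW.
have := xmin _ (convex_set_segment Xconv Xy Xx (ltW s0) s1).
have := convex_function_segment fconv Xy Xx (ltW s0) s1.
have -> : s *: y + (1 - s) *: x - x = s *: (y - x).
  by apply/rowP => i; rewrite !mxE; ring.
rewrite subrr enorm0 expr0n mulr0 addr0 enormZ exprMn gtr0_norm //.
have -> : c * (s ^+ 2 * enorm (y - x) ^+ 2) = s * (s * D) by rewrite /D; ring.
move=> h1 h2; rewrite -(ler_pM2l s0).
have : s * (s * D) <= s * e by rewrite ler_pM2l.
lra.
Qed.

(* With [y] the proximal point, [theta z + c |z - x|^2 <= theta y + c |y - x|^2]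
   and [theta z + kappa/2 |z - x|^2 >= V z x] sandwich [|z - x|]. *)
Lemma nearby_small_residual X theta V rho (kappa : R) x y : compact X ->
  convex_set X -> locally_lipschitz_on X theta -> 0 < rho -> 0 < kappa -> X x ->
  (forall z, X z -> theta z <= V z x) ->
  (forall z, X z -> V z x <= theta z + kappa / 2 * enorm (z - x) ^+ 2) ->
  argmin X (fun z => prox_surrogate V rho z x) y ->
  exists z, [/\ X z, enorm (x - z) <= (kappa / 2 + 1) * enorm (x - y) &
    (C_residual X theta z <=
      (2 * (kappa / 2 + (2 * rho)^-1 + 1) * enorm (x - z))%:E)%E].
Proof.
move=> Xc Xconv lip rho0 k0 Xx V_ge V_le [Xy ymin].
(* In the combined inequalities [|z - x|^2] has coefficient [c] on the left and
   [kappa / 2 + (2 rho)^-1] on the right; the surplus [1] is what bounds it. *)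
pose c := kappa / 2 + (2 * rho)^-1 + 1.
have m0 : 0 < (2 * rho)^-1 by rewrite invr_gt0 mulr_gt0.
have c0 : 0 < c by rewrite /c; lra.
have [z zmin] := prox_argmin_exists x c Xc (ex_intro _ x Xx) lip.
have Xz := zmin.1; exists z; split => //.
(* The squares compare with factor [kappa / 2 + 1]; being at least [1], it is relaxed to its square
   before roots are taken. *)
- have K1 : 1 <= kappa / 2 + 1 by lra.
  rewrite -(@ler_pXn2r _ 2) ?nnegrE ?mulr_ge0 ?enorm_ge0 //; last lra.
  rewrite exprMn (enormB x y) (enormB x z).
  apply: (@le_trans _ _ ((kappa / 2 + 1) * enorm (y - x) ^+ 2)).
    have := zmin.2 _ Xy; have := ymin _ Xz; have := V_ge _ Xy; have := V_le _ Xz.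
    rewrite /prox_surrogate /c; lra.
  by rewrite ler_wpM2r ?exprn_ge0 ?enorm_ge0 // expr2 ler_peMl //; lra.
- have := prox_clarke_normal Xconv (lip z Xz) zmin.
  move=> /(edist_set_le 0) /le_trans; apply.
  rewrite lee_fin sub0r enormN enormZ normrN gtr0_norm ?mulr_gt0 //.
  by rewrite (enormB x).
Qed.

End surrogate.

(** * Transfer of subregularity to the proximal residual *)

Theorem theorem11 (R : realType) (n : nat) (X : set 'rV[R]_n)
    (theta : 'rV[R]_n -> R) (V : 'rV[R]_n -> 'rV[R]_n -> R) (rho : R)
    (xhat : 'rV[R]_n)
    (X_compact : compact X) (X_convex : convex_set X)
    (theta_lip : locally_lipschitz_on X theta)
    (V_SR1 : SR1 X theta V) (V_SR2 : SR2 X theta V) (V_SR3 : SR3 X V)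
    (rho_gt0 : 0 < rho)
    (xhatX : X xhat) (xhat_fix : prox_map X V rho xhat = xhat)
    (xhat_subregular : exists delta eta : R,
      [/\ 0 < delta, 0 < eta &
          forall x, X x -> enorm (x - xhat) <= delta ->
            (edist_set x (C_stationary X theta)
               <= eta%:E * C_residual X theta x)%E]) :
  exists delta' eta' : R,
    [/\ 0 < delta', 0 < eta' &
        forall x, X x -> eball xhat delta' x ->
          (edist_set x (C_stationary X theta)
             <= (eta' * prox_residual X V rho x)%:E)%E].
Proof.
have proxP x := prox_mapP X_compact X_convex theta_lip V_SR1 V_SR3 rho_gt0 (x := x).
have [Vconv _ V_ge [kappa k0 V_le]] := V_SR1.
have m0 : 0 < (2 * rho)^-1 by rewrite invr_gt0 mulr_gt0.
have xhatS : C_stationary X theta xhat.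
  apply: V_SR2; split => //.
  apply: (@prox_fixed_argmin _ _ _ _ _ (2 * rho)^-1) => //.
  - exact: Vconv.
  - exact: ltW.
  - by have := proxP _ xhatX; rewrite xhat_fix.
have [delta [eta [delta0 eta0 subreg]]] := xhat_subregular.
pose K := kappa / 2 + 1.
pose L := 2 * (kappa / 2 + (2 * rho)^-1 + 1).
have K0 : 0 < K by rewrite /K; lra.
have L0 : 0 < L by rewrite /L; lra.
(* Half of [delta] is kept for the move from [x] to [z]. In [eta'], [K] pays for [|x - z|] and
   [eta * (L * K)] for the subregularity bound at [z]. *)
exists (delta / 2), (K + eta * (L * K)); split.
- by rewrite divr_gt0.
- by rewrite addr_gt0 // mulr_gt0 // mulr_gt0.
move=> x Xx x_near; rewrite /eball /= in x_near.
have [z [Xz xz res_z]] := nearby_small_residual X_compact X_convex theta_lip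
  rho_gt0 k0 Xx (V_ge x ^~ Xx) (V_le x ^~ Xx) (proxP x Xx).
have r0 : 0 <= prox_residual X V rho x by exact: enorm_ge0.
have LK0 : 0 <= eta * (L * K) * prox_residual X V rho x.
  by rewrite mulr_ge0 // ltW // mulr_gt0 // mulr_gt0.
rewrite mulrDl.
(* If the residual is large, [|x - xhat| <= delta / 2 < K r] with [xhat] stationary already gives
   the bound. *)
have [Kr|Kr] := leP (K * prox_residual X V rho x) (delta / 2); last first.
  apply: (le_trans (edist_set_le x xhatS)); rewrite lee_fin; lra.
have z_near : enorm (z - xhat) <= delta.
  apply: (le_trans (enorm_triangle x _ _)); rewrite enormB.
  by move: xz; rewrite -/K -/(prox_residual _ _ _ _); lra.
apply: (le_trans (edist_set_triangle x z _)); rewrite EFinD; apply: leeD.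
  by rewrite lee_fin.
apply: (le_trans (subreg z Xz z_near)).
rewrite -mulrA EFinM; apply: lee_wpmul2l; first by rewrite lee_fin ltW.
apply: (le_trans res_z); rewrite lee_fin -/L -mulrA ler_pM2l //.
Qed.
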